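(* For every $k\ge 1$, the problem PTBE-$k$ is polynomial-time reducible to the problem PBE-$(k+1)$.
   Context: Partitioned $T$-Coherent $k$-Page Book Embedding (PTBE-$k$): the input is a tree $T$ with leaf set $\mathcal{L}(T)$ and $k$ edge sets $E_1,\dots,E_k$, each consisting of pairs of leaves of $T$. A linear order $\mathcal{O}$ of $\mathcal{L}(T)$ is represented by $T$ if there is a planar drawing of $T$ in which all leaves lie on a horizontal line $\ell$ in the order $\mathcal{O}$ and all other vertices and edges of $T$ lie strictly on one side of $\ell$. Two edges $(a,b),(c,d)$ with four distinct endpoints alternate in a linear order if exactly one of $c,d$ lies strictly between $a$ and $b$. PTBE-$k$ asks whether there is a linear order of $\mathcal{L}(T)$ represented by $T$ in which, for each $i$, no two edges of $E_i$ alternate. Partitioned $k$-Page Book Embedding (PBE-$k$): given a finite vertex set $V$ and edge sets $E_1,\dots,E_k\subseteq V\times V$, decide whether there is a linear order of $V$ in which, for each $i$, no two edges of $E_i$ alternate. *)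

(* Defs.v *)
From HB Require Import structures.
From mathcomp Require Import all_boot all_order all_algebra.
From mathcomp Require Import all_classical all_reals all_analysis.

Set Implicit Arguments.
Unset Strict Implicit.
Unset Printing Implicit Defensive.

Import Order.TTheory GRing.Theory Num.Theory.
Import numFieldNormedType.Exports.

Local Open Scope classical_set_scope.

(* Deterministic Turing machines with one two-way infinite tape. In the tape
   alphabet [option (bool + work)], [None] is the blank, [Some (inl b)] is an
   input/output bit and [Some (inr x)] is an auxiliary symbol. *)

Variant move := MoveL | Stay | MoveR.

Record turing_machine := TuringMachine {
  state : finType;
  work : finType;
  start : state;
  final : pred state;
  delta : state -> option (bool + work) -> state * option (bool + work) * move
}.

Definition symbol (M : turing_machine) : Type := option (bool + work M).

Record config (M : turing_machine) := Config {
  cstate : state M;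
  chead : int;
  ctape : int -> symbol M
}.

Definition move_head (m : move) (z : int) : int :=
  match m with MoveL => (z - 1)%R | Stay => z | MoveR => (z + 1)%R end.

Definition step (M : turing_machine) (c : config M) : config M :=
  if final (cstate c) then c else
  let: (q, a, m) := delta (cstate c) (ctape c (chead c)) in
  Config q (move_head m (chead c))
    (fun z => if z == chead c then a else ctape c z).

(* The word occupies the cells 0, 1, ..., all the other cells being blank. *)
Definition word_tape (M : turing_machine) (w : seq bool) (z : int) : symbol M :=
  match z with
  | Posz i => nth None [seq Some (inl b) | b <- w] i
  | Negz _ => None
  end.

Definition init_config (M : turing_machine) (w : seq bool) : config M :=
  Config (start M) 0%R (word_tape M w).

Definition outputs_within (M : turing_machine) (w v : seq bool) (t : nat) :=
  let c := iter t (@step M) (init_config M w) in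
  final (cstate c) /\ ctape c =1 word_tape M v.

Definition polytime (g : seq bool -> seq bool) :=
  exists (M : turing_machine) (p : {poly nat}),
    forall w, outputs_within M w (g w) (horner p (size w)).

(* The instances are the elements of [pdata] satisfying [pvalid]; [pyes] is only
   meaningful on them. *)
Record problem := Problem {
  pdata : Type;
  pvalid : pdata -> Prop;
  pyes : pdata -> Prop;
  pencode : pdata -> seq bool;
  pencode_inj : injective pencode
}.

Definition polytime_reducible (A B : problem) :=
  exists (f : pdata A -> pdata B) (g : seq bool -> seq bool),
    [/\ polytime g,
        forall x, pvalid x -> g (pencode x) = pencode (f x) &
        forall x, pvalid x -> pvalid (f x) /\ (pyes x <-> pyes (f x))].

Notation edges n := {set 'I_n * 'I_n}.

Definition adj_matrix n (E : edges n) : seq bool :=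
  [seq e \in E | e <- enum {: 'I_n * 'I_n}].

Definition encode_graphs n (s : seq (edges n)) : seq bool :=
  nseq n true ++ false :: flatten [seq adj_matrix E | E <- s].

Lemma adj_matrix_inj n : injective (@adj_matrix n).
Proof.
move=> E F /eq_in_map EF; apply/setP => e.
by apply: EF; rewrite mem_enum.
Qed.

Lemma encode_graphs_order n m s t :
  @encode_graphs n s = @encode_graphs m t -> n = m.
Proof.
rewrite /encode_graphs.
by elim: n m {s t}(flatten _) (flatten _) => [|n IHn] [|m] //= u v [] /IHn ->.
Qed.

Lemma encode_graphs_inj n (s t : seq (edges n)) :
  size s = size t -> encode_graphs s = encode_graphs t -> s = t.
Proof.
move=> st /eqP; rewrite /encode_graphs eqseq_cat // eqxx /= eqseq_cons eqxx /=.
move/eqP; elim: s t st => [|E s IHs] [|F t] //= [st] /eqP.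
rewrite eqseq_cat ?size_map // => /andP[/eqP/adj_matrix_inj -> /eqP/IHs ->] //.
Qed.

(* A linear order of the set [D] is the sequence listing [D] in that order. *)
Definition linear_order (T : eqType) (D : {pred T}) (s : seq T) :=
  uniq s /\ s =i D.

Definition between (T : eqType) (s : seq T) (a b x : T) : bool :=
  (index a s < index x s < index b s) || (index b s < index x s < index a s).

Definition alternate (T : eqType) (s : seq T) (e f : T * T) : bool :=
  uniq [:: e.1; e.2; f.1; f.2] &&
  (between s e.1 e.2 f.1 (+) between s e.1 e.2 f.2).

Definition no_alternation n (s : seq 'I_n) (E : edges n) :=
  forall e f, e \in E -> f \in E -> ~~ alternate s e f.

Definition adj n (T : edges n) : rel 'I_n := fun u v => (u, v) \in T.

Definition is_tree n (T : edges n) :=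
  [/\ (0 < n)%N, symmetric (adj T), irreflexive (adj T),
      forall u v, connect (adj T) u v &
      forall c, ucycle (adj T) c -> (size c <= 2)%N].

Definition leaf n (T : edges n) : pred 'I_n := fun u => #|adj T u| == 1%N.

Section Drawing.
Variable R : realType.
Local Open Scope ring_scope.

Definition arc_between (p q : R * R) (A : set (R * R)) :=
  exists gamma : R -> R * R,
    [/\ {within `[0, 1], continuous gamma},
        {in `[0, 1] &, injective gamma},
        gamma 0 = p, gamma 1 = q & A = gamma @` `[0, 1]].

Definition planar_drawing n (T : edges n) (pos : 'I_n -> R * R)
    (arc : 'I_n -> 'I_n -> set (R * R)) :=
  [/\ injective pos,
      forall u v, adj T u v ->
        arc u v = arc v u /\ arc_between (pos u) (pos v) (arc u v),
      forall u v w, adj T u v -> arc u v (pos w) -> w = u \/ w = v &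
      forall u v u' v' p, adj T u v -> adj T u' v' ->
        ([set u; v] != [set u'; v'])%SET -> arc u v p -> arc u' v' p ->
        exists2 w, w \in ([set u; v] :&: [set u'; v'])%SET & p = pos w].

Definition strictly_on_one_side (l : R) (A : set (R * R)) :=
  (forall p, A p -> l < p.2) \/ (forall p, A p -> p.2 < l).

Definition represented n (T : edges n) (s : seq 'I_n) :=
  exists pos arc (l : R),
    [/\ planar_drawing T pos arc,
        forall u, leaf T u -> (pos u).2 = l,
        forall u v, leaf T u -> leaf T v -> (index u s < index v s)%N ->
          (pos u).1 < (pos v).1 &
        strictly_on_one_side l
          ([set p | exists2 u, ~~ leaf T u & p = pos u] `|`
           [set p | exists u v,
              [/\ adj T u v, arc u v p, p <> pos u & p <> pos v]])].

End Drawing.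

Record ptbe_data (k : nat) := PTBEData {
  ptbe_n : nat;
  ptbe_tree : edges ptbe_n;
  ptbe_pages : k.-tuple (edges ptbe_n)
}.

Definition ptbe_valid k (x : ptbe_data k) :=
  is_tree (ptbe_tree x) /\
  forall i e, e \in tnth (ptbe_pages x) i ->
    leaf (ptbe_tree x) e.1 /\ leaf (ptbe_tree x) e.2.

Definition ptbe_yes (R : realType) k (x : ptbe_data k) :=
  exists s, [/\ linear_order (leaf (ptbe_tree x)) s,
    represented R (ptbe_tree x) s &
    forall i, no_alternation s (tnth (ptbe_pages x) i)].

Definition ptbe_encode k (x : ptbe_data k) :=
  encode_graphs (ptbe_tree x :: ptbe_pages x).

Lemma ptbe_encode_inj k : injective (@ptbe_encode k).
Proof.
move=> [n T E] [m U F]; rewrite /ptbe_encode /= => TU.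
have nm := encode_graphs_order TU; case: m / nm U F TU => U F.
move/encode_graphs_inj; rewrite /= !size_tuple => /(_ erefl)[-> EF].
by congr PTBEData; apply: val_inj.
Qed.

Definition PTBE (R : realType) (k : nat) : problem :=
  @Problem (ptbe_data k) (@ptbe_valid k) (@ptbe_yes R k) (@ptbe_encode k)
    (@ptbe_encode_inj k).

Record pbe_data (k : nat) := PBEData {
  pbe_n : nat;
  pbe_pages : k.-tuple (edges pbe_n)
}.

Definition pbe_yes k (x : pbe_data k) :=
  exists s : seq 'I_(pbe_n x), linear_order predT s /\
    forall i, no_alternation s (tnth (pbe_pages x) i).

Definition pbe_encode k (x : pbe_data k) := encode_graphs (pbe_pages x).

Lemma pbe_encode_inj k : injective (@pbe_encode k).
Proof.
move=> [n E] [m F]; rewrite /pbe_encode /= => EF.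
have nm := encode_graphs_order EF; case: m / nm F EF => F.
move/encode_graphs_inj; rewrite !size_tuple => /(_ erefl) EF.
by congr PBEData; apply: val_inj.
Qed.

Definition PBE (k : nat) : problem :=
  @Problem (pbe_data k) (fun=> True) (@pbe_yes k) (@pbe_encode k)
    (@pbe_encode_inj k).

(* Main.v *)
Require Import Defs.
From mathcomp Require Import all_boot all_order all_algebra.
From mathcomp Require Import all_classical all_reals all_analysis.
From mathcomp Require Import zify ring lra.

(* The reduction keeps the vertices of the tree [T] and uses the edges of [T] as
   the additional page, so that even the encoding is unchanged.

   If [T] is drawn above a line, two vertex-disjoint subtrees cannot contain
   alternating pairs of leaves: the corresponding unions of arcs are disjoint
   compact sets, and fine chains of points in them would have to come close to
   each other by a parity argument. Hence, rooting [T] at the first leaf, the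
   preorder in which children are sorted by their first leaves is a one-page
   embedding of [T] that extends the order of the leaves.

   Conversely, from a one-page embedding with the vertices at the integers, draw
   an edge [(i, j)] as the graph of [(x - i) * (j - x) + base x] over [[i, j]],
   where [base x] is the product of the [(x - i) ^+ 2] over the leaves [i]: the
   leaves stay on the axis, and everything else is above it. *)

Set Implicit Arguments.
Unset Strict Implicit.
Unset Printing Implicit Defensive.

Import Order.TTheory GRing.Theory Num.Theory.
Import numFieldNormedType.Exports.

Local Open Scope classical_set_scope.
Local Open Scope ring_scope.

(** * Alternating chains of points *)

Lemma norm_pair_lt (R : realType) (u : R * R) (e : R) :
  (`|u| < e) = (`|u.1| < e) && (`|u.2| < e).
Proof. by rewrite prod_normE gt_max. Qed.

(** For short steps away from the origin this is the intersection number mod 2 of the step from [u]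
    to [v] with the vertical half-axis on the side [s]; a step with an end strictly on the other
    side counts as no crossing. *)
Definition crosses_axis (R : realType) (s : R) (u v : R * R) : bool :=
  [&& 0 <= s * u.2, 0 <= s * v.2 & (0 < u.1) (+) (0 < v.1)].

(** The sign change towards [v] bounds the first coordinate of [u], and the one towards [w] bounds
    the second. *)
Lemma axis_crossing_small (R : realType) (s e : R) (u v w : R * R) :
  s = 1 \/ s = -1 -> `|u - v| < e -> `|u - w| < e ->
  0 <= s * u.2 -> s * w.2 < 0 -> (0 < u.1) (+) (0 < v.1) -> `|u| < e.
Proof.
move=> s1; rewrite !norm_pair_lt /= !ltr_norml.
move=> /andP[/andP[uv1 uv2] _] /andP[_ /andP[uw1 uw2]] uy wy uv.
apply/andP; split; last first.
  by case: s1 uy wy => ->; rewrite ?mul1r ?mulN1r => uy wy; apply/andP; split; lra.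
by case: ltP uv => ux /=; rewrite ?addbT -?leNgt => vx; apply/andP; split; lra.
Qed.

(** A triangle with short sides and vertices far from the origin does not wind around it, so
    crossings add up along its sides. If exactly two vertices lie on the side [s], the edge joining
    them cannot cross, by [axis_crossing_small] with the third vertex as [w]. *)
Lemma crosses_axis_triangle (R : realType) (s e : R) (u v w : R * R) :
  s = 1 \/ s = -1 ->
  `|u - v| < e -> `|v - w| < e -> `|u - w| < e ->
  e <= `|u| -> e <= `|v| -> e <= `|w| ->
  crosses_axis s u v (+) crosses_axis s v w = crosses_axis s u w.
Proof.
move=> s1 uv vw uw; rewrite ![e <= _]leNgt /crosses_axis => u0 v0 w0.
have small := @axis_crossing_small R s e _ _ _ s1.
case: (leP 0 (s * u.2)) => uy; case: (leP 0 (s * v.2)) => vy;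
  case: (leP 0 (s * w.2)) => wy //=; rewrite ?addbF.
- by do 3!case: (0 < _).
- by apply: contraNF u0 => /(small _ _ _ uv uw); apply.
- by apply/esym; apply: contraNF u0 => /(small _ _ _ uw uv); apply.
- by apply: contraNF v0; rewrite distrC in uv => /(small _ _ _ vw uv); apply.
Qed.

Lemma telescope_addb (f : nat -> bool) m :
  \big[addb/false]_(0 <= i < m) (f i (+) f i.+1) = f 0%N (+) f m.
Proof.
elim: m => [|m IHm]; first by rewrite big_geq // addbb.
by rewrite big_nat_recr //= IHm -addbA addKb.
Qed.

(* A parity count in the spirit of Sperner's lemma on the grid of differences
   [p i - q j]: the number of crossings of the vertical half-axis along a row
   has a parity independent of the row, yet it is odd for [j = 0] and even for
   [j = n]. The sign [s] tells on which side of the line the chains lie. *)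
Lemma alternating_chains_meet (R : realType) (s l e : R) (p q : nat -> R * R)
    m n :
  s = 1 \/ s = -1 ->
  (p 0%N).2 = l -> (p m).2 = l -> (q 0%N).2 = l -> (q n).2 = l ->
  (p 0%N).1 < (q 0%N).1 -> (q 0%N).1 < (p m).1 -> (p m).1 < (q n).1 ->
  (forall i, (i <= m)%N -> 0 <= s * ((p i).2 - l)) ->
  (forall j, (j <= n)%N -> q j = q 0%N \/ q j = q n \/ 0 < s * ((q j).2 - l)) ->
  (forall i, (i < m)%N -> `|p i - p i.+1| < e) ->
  (forall j, (j < n)%N -> `|q j - q j.+1| < e) ->
  e <= (q n).1 - (q 0%N).1 ->
  exists i j, [/\ (i <= m)%N, (j <= n)%N & `|p i - q j| < e + e].
Proof.
move=> s1 p0 pm q0 qn lt1 lt2 lt3 p_side q_side p_step q_step eq_.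
apply: contrapT => far.
have {}far i j : (i <= m)%N -> (j <= n)%N -> e + e <= `|p i - q j|.
  by move=> im jn; rewrite leNgt; apply/negP => ?; apply: far; exists i, j.
pose F i j := p i - q j.
pose h j := \big[addb/false]_(0 <= i < m) crosses_axis s (F i j) (F i.+1 j).
(* The diagonal cuts each grid square into two triangles. It has length less than [e + e], which is
   where the doubled threshold comes from. *)
have square i j : (i < m)%N -> (j < n)%N ->
    crosses_axis s (F i j) (F i.+1 j) (+) crosses_axis s (F i.+1 j) (F i.+1 j.+1)
    = crosses_axis s (F i j) (F i j.+1) (+)
      crosses_axis s (F i j.+1) (F i.+1 j.+1).
  move=> im jn.
  have e0 : 0 < e by apply: le_lt_trans (p_step _ im).
  have dp j' : `|F i j' - F i.+1 j'| < e.
    by rewrite (_ : _ - _ = p i - p i.+1) ?p_step // /F; ring.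
  have dq i' : `|F i' j - F i' j.+1| < e.
    rewrite (_ : _ - _ = - (q j - q j.+1)) ?normrN ?q_step // /F; ring.
  have dd : `|F i j - F i.+1 j.+1| < e + e.
    rewrite (_ : _ - _ = (F i j - F i.+1 j) + (F i.+1 j - F i.+1 j.+1)).
      by apply: le_lt_trans (ler_normD _ _) _; rewrite ltrD.
    by ring.
  have up x : x < e -> x < e + e by lra.
  rewrite !(@crosses_axis_triangle R s (e + e)) //; do ?[exact: up];
    by rewrite /F far // ltnW.
(* [F 0 j] lies on the side [s] only if [q j] is an end of its chain, and both ends are to the right
   of [p 0]. *)
have p_left j : (j < n)%N -> crosses_axis s (F 0%N j) (F 0%N j.+1) = false.
  move=> jn; apply/negbTE/negP.
  have no k : (k <= n)%N -> 0 <= s * (F 0%N k).2 -> (0 < (F 0%N k).1) = false.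
    move=> kn; rewrite /F /= p0; case: (q_side k kn) => [->|[->|qk]].
    - by move=> _; apply/negbTE; rewrite -leNgt; lra.
    - by move=> _; apply/negbTE; rewrite -leNgt; lra.
    - by rewrite -opprB mulrN oppr_ge0 leNgt qk.
  by case/and3P=> /(no _ (ltnW jn)) -> /(no _ jn) ->.
(* Here too [q j] and [q j.+1] must be ends of the chain. As [p m] lies between the two ends, a
   crossing would jump from one to the other, further than a single step allows. *)
have p_right j : (j < n)%N -> crosses_axis s (F m j) (F m j.+1) = false.
  move=> jn; apply/negbTE/negP.
  have ends k : (k <= n)%N -> 0 <= s * (F m k).2 -> q k = q 0%N \/ q k = q n.
    move=> kn; rewrite /F /= pm; case: (q_side k kn) => [->|[->|qk]]; auto.
    by rewrite -opprB mulrN oppr_ge0 leNgt qk.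
  case/and3P=> /(ends _ (ltnW jn)) E1 /(ends _ jn) E2; rewrite /F /=.
  have := q_step _ jn; rewrite norm_pair_lt /= ltr_norml => /andP[/andP[+ +] _].
  by case: E1 E2 => -> [] -> => ? ?; rewrite ?addbb // => _; lra.
(* Summing [square] along a row, the vertical sides telescope to the two border columns, which
   contribute nothing. *)
have hS j : (j <= n)%N -> h j = h 0%N.
  elim: j => // j IHj jn; apply: etrans (IHj (ltnW jn)); apply/esym.
  have : \big[addb/false]_(0 <= i < m)
     (crosses_axis s (F i j) (F i.+1 j) (+) crosses_axis s (F i j.+1) (F i.+1 j.+1))
     = false.
    transitivity (\big[addb/false]_(0 <= i < m)
      (crosses_axis s (F i j) (F i j.+1) (+)
       crosses_axis s (F i.+1 j) (F i.+1 j.+1))).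
      apply: eq_big_nat => i /andP[_ im]; have := square i j im jn.
      by do 4!case: crosses_axis.
    by rewrite (telescope_addb (fun i => crosses_axis s (F i j) (F i j.+1)))
      p_left ?p_right.
  by rewrite big_split /= -/(h j) -/(h j.+1); do 2!case: (h _).
(* When [q j] is on the line, every difference of the row is on the side [s], so the crossings are
   just sign changes of the first coordinate. *)
have row j : (q j).2 = l -> h j = (0 < (F 0%N j).1) (+) (0 < (F m j).1).
  move=> qj; rewrite -(telescope_addb (fun i => 0 < (F i j).1)).
  apply: eq_big_nat => i /andP[_ im].
  by rewrite /crosses_axis /F /= qj !p_side // ltnW.
have := hS n (leqnn n); rewrite !row // /F /= !subr_gt0 lt2.
by rewrite !ltNge (ltW lt1) (ltW lt3) (ltW (lt_trans lt1 (lt_trans lt2 lt3))).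
Qed.

(** * Drawings of disjoint subtrees *)

Definition chained (R : realType) (K : set (R * R)) (e : R) (x y : R * R) :=
  exists t, [/\ path (fun u v => `|u - v| < e) x t, last x t = y &
                forall u, u \in x :: t -> K u].

Lemma chained_sub (R : realType) (K L : set (R * R)) (e : R) x y :
  K `<=` L -> chained K e x y -> chained L e x y.
Proof. by move=> KL [t [xt ty Kt]]; exists t; split=> // u /Kt/KL. Qed.

Lemma chained_trans (R : realType) (K : set (R * R)) (e : R) y x z :
  chained K e x y -> chained K e y z -> chained K e x z.
Proof.
move=> [t [xt ty Kt]] [r [yr rz Kr]]; exists (t ++ r); split.
- by rewrite cat_path xt ty.
- by rewrite last_cat ty.
- move=> u; rewrite -cat_cons mem_cat => /orP[/Kt//|ur].
  by apply: Kr; rewrite inE ur orbT.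
Qed.

(** The points of [K] that chains from [x] reach form a nonempty subset that is both open and closed
    in [K]. *)
Lemma connected_chained (R : realType) (K : set (R * R)) (e : R) x y :
  connected K -> 0 < e -> K x -> K y -> chained K e x y.
Proof.
move=> cK e0 Kx Ky; pose B := [set z | chained K e x z].
have BK z : B z -> K z.
  by case=> t [_ <- Kt]; apply: Kt; rewrite mem_last.
have Bstep z w : B z -> K w -> `|z - w| < e -> B w.
  move=> Bz Kw zw; apply: (chained_trans Bz); exists [:: w]; split=> //=.
    by rewrite zw.
  by move=> u; rewrite !inE => /orP[]/eqP-> //; exact: BK.
suff BE : B = K by change (B y); rewrite BE.
apply: cK.
- by exists x, [::]; split=> // u; rewrite inE => /eqP->.
- exists (\bigcup_(z in B) ball z e).
    by apply: bigcup_open => z _; exact: ball_open.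
  apply/seteqP; split=> z.
    by move=> Bz; split; [exact: BK|exists z => //; exact: ballxx].
  by case=> Kz [w Bw]; rewrite -ball_normE; exact: Bstep.
- exists (~` \bigcup_(z in K `\` B) ball z e).
    by apply: open_closedC; apply: bigcup_open => z _; exact: ball_open.
  apply/seteqP; split=> z.
    move=> Bz; split; first exact: BK.
    case=> w [Kw nBw]; rewrite -ball_normE /ball_ /= distrC => wz.
    exact/nBw/(Bstep z).
  case=> Kz nz; apply: contrapT => nBz; apply: nz.
  by exists z; [split|exact: ballxx].
Qed.

(** The set of differences is compact, hence closed, and misses 0; so it misses a ball around 0. *)
Lemma compact_separated (R : realType) (K L : set (R * R)) :
  compact K -> compact L -> (forall x, K x -> L x -> False) ->
  exists2 e : R, 0 < e & forall x y, K x -> L y -> e <= `|x - y|.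
Proof.
move=> cK cL KL0; pose f (z : (R * R) * (R * R)) := z.1 - z.2.
have cf : continuous f.
  by move=> z; apply: cvgB; [exact: cvg_fst|exact: cvg_snd].
have := compact_closed (@norm_hausdorff _ _)
  (continuous_compact (continuous_subspaceT cf) (compact_setX cK cL)).
rewrite -openC openE => /(_ 0); rewrite /interior.
have f0 : (~` [set f z | z in K `*` L]) 0.
  case=> -[x y] [/= Kx Ly] /eqP; rewrite subr_eq0 => /eqP xy.
  by apply: (KL0 x) => //; rewrite /= in xy; rewrite xy.
move=> /(_ f0)/nbhs_ballP[e /= e0 sub]; exists e => // x y Kx Ly.
rewrite leNgt; apply/negP => xy; apply: (sub (x - y)); last by exists (x, y).
by rewrite -ball_normE /ball_ /= sub0r normrN.
Qed.

(** Vertices occur only as ends of arcs, so a vertex with no neighbour in [A] contributes no point;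
    hence the condition [a != b] in [drawn_chained]. *)
Definition drawn (R : realType) n (T : edges n)
    (arc : 'I_n -> 'I_n -> set (R * R)) (A : {set 'I_n}) : set (R * R) :=
  [set p | exists u v, [/\ adj T u v, u \in A, v \in A & arc u v p]].

Definition adj_in n (T : edges n) (A : {set 'I_n}) : rel 'I_n :=
  fun u v => [&& adj T u v, u \in A & v \in A].

Lemma arc_ends (R : realType) (p q : R * R) A :
  arc_between p q A -> A p /\ A q.
Proof.
by case=> g [_ _ <- <- ->]; split; [exists 0|exists 1] => //=;
  rewrite in_itv /= ?lexx ?ler01.
Qed.

Lemma drawn_compact (R : realType) n (T : edges n) pos arc A :
  @planar_drawing R n T pos arc -> compact (drawn T arc A).
Proof.
case=> _ arcT _ _.
rewrite (_ : drawn T arc A = \bigcup_(z in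
    [set` [pred z : 'I_n * 'I_n | adj_in T A z.1 z.2]]) arc z.1 z.2).
  rewrite bigcup_pred; apply: bigsetU_compact => -[u v] /= /and3P[uv _ _].
  have [_ [g [cg _ _ _ ->]]] := arcT _ _ uv.
  by apply: continuous_compact => //; exact: segment_compact.
apply/seteqP; split=> p.
  by move=> [u [v [uv uA vA uvp]]]; exists (u, v) => //=; exact/and3P.
by move=> [[u v] /= /and3P[uv uA vA] uvp]; exists u, v.
Qed.

Lemma drawn_chained (R : realType) n (T : edges n) pos arc A (e : R) a b :
  @planar_drawing R n T pos arc -> 0 < e ->
  connect (adj_in T A) a b -> a != b ->
  chained (drawn T arc A) e (pos a) (pos b).
Proof.
case=> _ arcT _ _ e0 /connectP[t + ->].
have ends u v : adj_in T A u v -> drawn T arc A (pos u) /\ drawn T arc A (pos v).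
  move=> /and3P[uv uA vA]; have [_ ab] := arcT _ _ uv.
  have [? ?] := arc_ends ab.
  by split; exists u, v.
have : drawn T arc A (pos a) \/ t = [::] -> path (adj_in T A) a t ->
    a != last a t -> chained (drawn T arc A) e (pos a) (pos (last a t)).
  case=> [Ka|-> //=]; last by rewrite eqxx.
  move=> + _; elim: t a Ka => [|v t IHt] u Ku /=.
    by move=> _; exists [::]; split=> // p; rewrite inE => /eqP->.
  case/andP=> uv; have [_ Kv] := ends _ _ uv; move/(IHt _ Kv).
  apply: chained_trans; move: (uv) => /and3P[uTv uA vA].
  have [_ ab] := arcT _ _ uTv; have [? ?] := arc_ends ab.
  apply: (@chained_sub _ (arc u v)).
    by move=> p uvp; exists u, v.
  apply: connected_chained => //; case: ab => g [cg _ _ _ ->].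
  by apply: connected_continuous_connected => //; exact: segment_connected.
case: t => [|v t] chain; first by move=> /= _; rewrite eqxx.
move=> at_; apply: chain => //; left.
by move: at_ => /= /andP[/ends[]].
Qed.

(** Disjoint vertex sets have disjoint compact drawings, which stay a positive distance apart,
    whereas [alternating_chains_meet] brings them arbitrarily close. The chain in [A2] can touch the
    line only at [c] and [d], the only leaves that [A2] may contain. *)
Lemma represented_not_alternating (R : realType) n (T : edges n) s
    (A1 A2 : {set 'I_n}) a b c d :
  represented R T s -> (forall u, u \in A1 -> u \notin A2) ->
  leaf T a -> leaf T b -> leaf T c -> leaf T d ->
  (forall u, u \in A1 -> leaf T u -> u = a \/ u = b) ->
  (forall u, u \in A2 -> leaf T u -> u = c \/ u = d) ->
  connect (adj_in T A1) a b -> connect (adj_in T A2) c d ->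
  (index a s < index c s)%N -> (index c s < index b s)%N ->
  (index b s < index d s)%N -> False.
Proof.
move=> [pos [arc [l [drawing on_l x_lt one_side]]]] A12 la lb lc ld lA1 lA2
  cab ccd ac cb bd.
have [sg [sg1 side]] : exists sg : R, (sg = 1 \/ sg = -1) /\
    forall p, ([set p | exists2 u, ~~ leaf T u & p = pos u] `|`
      [set p | exists u v, [/\ adj T u v, arc u v p, p <> pos u & p <> pos v]]) p ->
    0 < sg * (p.2 - l).
  case: one_side => side; [exists 1|exists (-1)]; split; auto => p /side;
    by rewrite ?mul1r ?mulN1r; lra.
have drawnP A p : drawn T arc A p ->
    (exists u, [/\ u \in A, leaf T u & p = pos u]) \/ 0 < sg * (p.2 - l).
  move=> [u [v [uv uA vA uvp]]].
  have at_vertex w : w \in A -> p = pos w ->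
      (exists u, [/\ u \in A, leaf T u & p = pos u]) \/ 0 < sg * (p.2 - l).
    move=> wA pw; case: (boolP (leaf T w)) => lw; first by left; exists w.
    by right; apply: side; left; exists w.
  have [/at_vertex|pu] := pselect (p = pos u); first exact.
  have [/at_vertex|pv] := pselect (p = pos v); first exact.
  by right; apply: side; right; exists u, v.
have [e0 e0_gt0 far] : exists2 e : R, 0 < e & forall x y,
    drawn T arc A1 x -> drawn T arc A2 y -> e <= `|x - y|.
  apply: compact_separated; [exact: drawn_compact drawing
    |exact: drawn_compact drawing|move=> p].
  move=> [u [v [uv uA vA uvp]]] [u' [v' [uv' uA' vA' uvp']]].
  case: drawing => _ _ _ /(_ u v u' v' p uv uv').
  have meet w : w \in [set u; v]%SET -> w \in [set u'; v']%SET -> False.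
    move=> w1 w2; have w1A : w \in A1 by case/set2P: w1 => ->.
    have w2A : w \in A2 by case/set2P: w2 => ->.
    by have := A12 w w1A; rewrite w2A.
  case=> //; last by move=> w /setIP[w1 w2] _; exact: (meet w).
  by apply/eqP => E; apply: (meet u); rewrite -?E set21.
have {ac cb bd} [ac cb bd] :
    [/\ (pos a).1 < (pos c).1, (pos c).1 < (pos b).1 & (pos b).1 < (pos d).1].
  by split; apply: x_lt.
have ab : a != b by apply: contraTneq ac => ->; rewrite -leNgt ltW.
have cd : c != d by apply: contraTneq cb => ->; rewrite -leNgt ltW.
(* The first bound makes [e + e] at most the separation [e0]; the second prevents a step from [c]
   directly to [d]. *)
pose e := Num.min (e0 / 2) ((pos d).1 - (pos c).1).
have e_gt0 : 0 < e by rewrite lt_min; apply/andP; split; lra.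
have [t [at_ tb Kt]] := drawn_chained drawing e_gt0 cab ab.
have [r [cr rd Kr]] := drawn_chained drawing e_gt0 ccd cd.
pose p i := nth (pos a) (pos a :: t) i; pose q j := nth (pos c) (pos c :: r) j.
have pm : p (size t) = pos b by rewrite /p -tb (last_nth (pos a)).
have qn : q (size r) = pos d by rewrite /q -rd (last_nth (pos c)).
have Kp i : (i <= size t)%N -> drawn T arc A1 (p i).
  by move=> it; apply: Kt; rewrite mem_nth.
have Kq j : (j <= size r)%N -> drawn T arc A2 (q j).
  by move=> jr; apply: Kr; rewrite mem_nth.
have [||||||||||||i [j [it jr]]] :=
    @alternating_chains_meet R sg l e p q (size t) (size r) sg1.
- exact: on_l.
- by rewrite pm on_l.
- exact: on_l.
- by rewrite qn on_l.
- by [].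
- by rewrite pm.
- by rewrite pm qn.
- move=> i /Kp/drawnP[[u [_ lu ->]]|/ltW//].
  by rewrite on_l // subrr mulr0.
- move=> j /Kq/drawnP[[u [uA lu ->]]|]; last by auto.
  by rewrite qn; case: (lA2 u uA lu) => ->; auto.
- by move=> i it; move/(pathP (pos a)): at_ => /(_ i it).
- by move=> j jr; move/(pathP (pos c)): cr => /(_ j jr).
- by rewrite qn /e ge_min lexx orbT.
apply/negP; rewrite -leNgt; apply: le_trans (far _ _ (Kp _ it) (Kq _ jr)).
have : e <= e0 / 2 by rewrite /e ge_min lexx.
by lra.
Qed.

(** * From one-page embeddings to drawings *)

Lemma no_alternationP n (T : edges n) (s : seq 'I_n) :
  symmetric (adj T) -> (forall u, u \in s) ->
  no_alternation s T <->
  (forall a b c d, adj T a b -> adj T c d -> (index a s < index c s)%N ->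
     (index c s < index b s)%N -> (index b s < index d s)%N -> False).
Proof.
move=> symT s_full.
have idx_neq u v : u != v -> index u s != index v s.
  apply: contra => /eqP uv; apply/eqP.
  by rewrite -[u](nth_index u (s_full u)) uv nth_index.
split=> [noalt a b c d ab cd ac cb bd|order [a b] [c d] ab cd].
  have := noalt _ _ ab cd; rewrite /alternate /between /= !inE.
  have neq u v : (index u s < index v s)%N -> (u == v) = false.
    by move=> uv; apply: contraTF uv => /eqP ->; rewrite ltnn.
  rewrite [_ == c]neq // [a == b]neq; last by lia.
  rewrite [a == d]neq; last by lia.
  rewrite [b == c]eq_sym [c == b]neq // [b == d]neq // [c == d]neq; last by lia.
  by lia.
apply/negP => /andP[/= uq bt]; move: uq; rewrite !inE !negb_or.
case/andP=> /and3P[ab' ac' ad'] /andP[/andP[bc' bd'] /andP[cd' _]].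
move: ab' ac' ad' bc' bd' cd' => /idx_neq + /idx_neq + /idx_neq + /idx_neq +
  /idx_neq + /idx_neq.
have ba : adj T b a by rewrite symT.
have dc : adj T d c by rewrite symT.
have := order a b c d ab cd; have := order a b d c ab dc.
have := order b a c d ba cd; have := order b a d c ba dc.
have := order c d a b cd ab; have := order c d b a cd ba.
have := order d c a b dc ab; have := order d c b a dc ba.
move: bt {order}; rewrite /between /=.
move: (index a s) (index b s) (index c s) (index d s) => ia ib ic id.
by lia.
Qed.

Lemma ltn_index_filter (T : eqType) (P : pred T) (s : seq T) u v :
  P u -> P v ->
  (index u [seq x <- s | P x] < index v [seq x <- s | P x])%N =
  (index u s < index v s)%N.
Proof.
move=> Pu Pv; elim: s => //= x s IHs; case: ifP => Px /=.
  by case: (x == u); case: (x == v).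
have ne w : P w -> (x == w) = false by apply: contraTF => /eqP <-; rewrite Px.
by rewrite !ne.
Qed.

(** The two parabolas have the same leading coefficient, so their difference is affine. For nested
    intervals it is nonnegative at the ends of the inner one, and can vanish only at a shared
    end. *)
Lemma nested_parabolas_meet (R : realType) (a b c d z : R) :
  a < b -> c < d -> a <= c -> ~ (c < b /\ b < d /\ a < c) ->
  ~ (a = c /\ b = d) ->
  a <= z <= b -> c <= z <= d -> (z - a) * (b - z) = (z - c) * (d - z) ->
  (z = a \/ z = b) /\ (z = c \/ z = d).
Proof.
move=> ab cd ac nalt neq /andP[az zb] /andP[cz zd] E.
have [bc|cb] := leP b c; first by split; [right|left]; lra.
have [Eac|nac] := eqVneq a c.
  suff : z = a by move=> ->; split; left.
  have /eqP : (z - a) * (b - d) = 0.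
    by rewrite -Eac in E; apply/eqP; rewrite -subr_eq0 in E *; nra.
  rewrite mulf_eq0 !subr_eq0 => /orP[/eqP//|/eqP bd].
  by case: neq.
have {ac nac}ac : a < c by rewrite lt_neqAle nac.
have db : d <= b by rewrite leNgt; apply/negP => bd; apply: nalt.
have Ec : 0 < (c - a) * (b - c) by apply: mulr_gt0; lra.
have Ed : 0 <= (d - a) * (b - d) by apply: mulr_ge0; lra.
(* Linear interpolation of the affine difference from its values at [c] and [d]. *)
have L : (d - z) * ((c - a) * (b - c)) + (z - c) * ((d - a) * (b - d)) =
    (d - c) * ((z - a) * (b - z) - (z - c) * (d - z)) by ring.
rewrite E subrr mulr0 in L.
have zd' : z = d.
  apply/eqP; rewrite eq_le zd /= -subr_le0 leNgt; apply/negP => dz.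
  have : 0 < (d - z) * ((c - a) * (b - c)) by apply: mulr_gt0.
  have : 0 <= (z - c) * ((d - a) * (b - d)) by apply: mulr_ge0 => //; lra.
  by lra.
split; right=> //; apply/eqP; rewrite eq_le zb /= leNgt; apply/negP => zb'.
have : 0 < (z - c) * ((d - a) * (b - d)).
  by rewrite zd' in zb' *; apply: mulr_gt0; [lra|apply: mulr_gt0; lra].
by rewrite zd' subrr mul0r in L *; lra.
Qed.

Lemma mul_between_ge0 (R : realType) (a b z : R) :
  a < b -> (0 <= (z - a) * (b - z)) = (a <= z <= b).
Proof.
move=> ab; apply/idP/andP => [h|[? ?]]; last by apply: mulr_ge0; lra.
by split; rewrite leNgt; apply/negP => ?; nra.
Qed.

Lemma represented_of_book (R : realType) n (T : edges n) (s : seq 'I_n) :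
  symmetric (adj T) -> irreflexive (adj T) -> (forall u, u \in s) ->
  no_alternation s T -> represented R T [seq u <- s | leaf T u].
Proof.
move=> symT irrT s_full /(no_alternationP symT s_full) noalt.
pose x u : R := (index u s)%:R.
have x_inj : injective x.
  move=> u v /eqP; rewrite eqr_nat => /eqP uv.
  by rewrite -[u](nth_index u (s_full u)) uv nth_index.
pose base : {poly R} := \prod_(w | leaf T w) ('X - (x w)%:P) ^+ 2.
have baseE z : base.[z] = \prod_(w | leaf T w) (z - x w) ^+ 2.
  by rewrite horner_prod; apply: eq_bigr => w _; rewrite !hornerE.
have base_ge0 z : 0 <= base.[z].
  by rewrite baseE; apply: prodr_ge0 => w _; exact: sqr_ge0.
have base_leaf u : leaf T u -> base.[x u] = 0.
  by move=> lu; rewrite baseE (bigD1 u) //= subrr expr0n mul0r.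
have base_inner u : ~~ leaf T u -> 0 < base.[x u].
  move=> lu; rewrite baseE; apply: prodr_gt0 => w lw.
  rewrite exprn_even_gt0 //= subr_eq0; apply: contraNneq lu => /x_inj ->.
  by [].
pose pos u := (x u, base.[x u]).
pose f (a b z : R) := (z - a) * (b - z) + base.[z].
(* The sign condition describes the interval between [x u] and [x v] without deciding which end is
   on the left. *)
pose arc u v := [set p : R * R | 0 <= (p.1 - x u) * (x v - p.1) /\
  p.2 = f (x u) (x v) p.1].
have fC (a b z : R) : (z - a) * (b - z) = (z - b) * (a - z) by ring.
have arcC u v : arc u v = arc v u.
  by rewrite /arc /f; apply/funext => p /=; rewrite fC.
have adj_neq u v : adj T u v -> x u != x v.
  by move=> uv; apply: contraTneq uv => /x_inj ->; rewrite irrT.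
exists pos, arc, 0; split.
- split.
  + by move=> u v [/x_inj].
  + move=> u v /adj_neq uv; split; first exact: arcC.
    (* The arc is parametrised by its abscissa, rescaled to the unit interval; both coordinates are
       polynomials, hence continuous. *)
    pose line : {poly R} := (x u)%:P + (x v - x u) *: 'X.
    have lineE t : line.[t] = x u + (x v - x u) * t by rewrite /line !hornerE.
    pose g : {poly R} := (line - (x u)%:P) * ((x v)%:P - line) + (base \Po line).
    have gE t : g.[t] = f (x u) (x v) line.[t].
      by rewrite /g /f !(hornerE, horner_comp).
    have duv : x v - x u != 0 by rewrite subr_eq0 eq_sym.
    exists (fun t => (line.[t], g.[t])); split.
    * apply: continuous_subspaceT => t.
      exact: (cvg_pair (@continuous_horner R line t) (@continuous_horner R g t)).
    * move=> t1 t2 _ _ [+ _]; rewrite !lineE => /addrI.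
      exact: mulfI.
    * by rewrite gE lineE mulr0 addr0 /f subrr mul0r add0r.
    * have -> : g.[1] = base.[x v].
        rewrite gE lineE mulr1 addrC subrK /f subrr mulr0 add0r //.
      by rewrite lineE mulr1 addrC subrK.
    * apply/seteqP; split=> [[z y]|_ [t /= t01 <-]].
        rewrite /arc /= => -[h ->].
        pose t := (z - x u) / (x v - x u).
        have zt : line.[t] = z by rewrite lineE /t mulrC divfK // addrC subrK.
        exists t; last by rewrite gE zt.
        have : 0 <= t * (1 - t).
          have -> : t * (1 - t) = (z - x u) * (x v - z) / (x v - x u) ^+ 2.
            by rewrite /t; field.
          by rewrite divr_ge0 ?sqr_ge0.
        by rewrite in_itv /= -{1}[t]subr0 mul_between_ge0 ?ltr01.
      split; last by rewrite /= gE.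
      rewrite /= lineE (_ : _ * _ = (x v - x u) ^+ 2 * ((t - 0) * (1 - t))).
        by rewrite mulr_ge0 ?sqr_ge0 // mul_between_ge0 ?ltr01.
      by ring.
  (* All vertices lie on the graph of [base], which an arc meets only at its own ends. *)
  + move=> u v w uv [_ /=] /eqP; rewrite /f -subr_eq0 opprD addrCA subrr addr0.
    rewrite oppr_eq0 mulf_eq0 !subr_eq0 => /orP[]/eqP/x_inj; auto.
  + move=> u v u' v' p uv uv' neq.
    wlog le_uv : u v uv neq / x u < x v => [wl|].
      case/orP: (lt_total (adj_neq _ _ uv)) => lt_uv; first exact: wl.
      rewrite arcC [[set u; v]%SET]finset.setUC; apply: wl => //.
        by rewrite symT.
      by rewrite finset.setUC.
    wlog le_uv' : u' v' uv' neq / x u' < x v' => [wl|].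
      case/orP: (lt_total (adj_neq _ _ uv')) => lt_uv'; first exact: wl.
      rewrite (arcC u') [[set u'; v']%SET]finset.setUC; apply: wl => //.
        by rewrite symT.
      by rewrite [in X in _ != X]finset.setUC.
    wlog le_uu' : u v u' v' uv uv' neq le_uv le_uv' / x u <= x u' => [wl|].
      case/orP: (le_total (x u) (x u')) => le_uu'; first exact: wl.
      move=> up up'; rewrite finset.setIC; apply: wl => //.
      by rewrite eq_sym.
    move=> [+ pE] [+ pE']; rewrite !mul_between_ge0 // => zu zu'.
    (* The common term [base] cancels, leaving two bare parabolas. *)
    move: pE'; rewrite pE /f => /addIr E.
    have [||zuv zuv'] := nested_parabolas_meet le_uv le_uv' le_uu' _ _ zu zu' E.
    * rewrite !ltr_nat => -[h1 [h2 h3]]; exact: (noalt u v u' v').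
    * by case=> /x_inj Eu /x_inj Ev; rewrite Eu Ev eqxx in neq.
    have vert w : p.1 = x w -> w \in [set u; v]%SET -> p = pos w.
      move=> pw /set2P wuv; rewrite /pos [p]surjective_pairing pE /f pw.
      by congr pair; case: wuv => ->; rewrite subrr ?mul0r ?mulr0 add0r.
    have pick w w' : p.1 = x w -> p.1 = x w' -> w \in [set u; v]%SET ->
        w' \in [set u'; v']%SET ->
        exists2 w0, w0 \in ([set u; v] :&: [set u'; v'])%SET & p = pos w0.
      move=> pw pw' wu wu'; exists w; last exact: vert.
      rewrite finset.in_setI wu /=.
      by have /x_inj -> : x w = x w' by rewrite -pw.
    by case: zuv => h; case: zuv' => h'; apply: (pick _ _ h h');
      rewrite ?set21 ?set22.
- by move=> u; exact: base_leaf.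
- by move=> u v lu lv; rewrite ltn_index_filter // /pos /= ltr_nat.
- left=> p [[u lu ->]|[u [v [uv [p0 pE] pu pv]]]]; first exact: base_inner.
  rewrite pE /f; apply: ltr_wpDr => //; rewrite lt_neqAle p0 andbT eq_sym.
  have vert w : p.1 = x w -> w = u \/ w = v -> p = pos w.
    move=> pw wuv; rewrite /pos [p]surjective_pairing pE /f pw.
    by congr pair; case: wuv => ->; rewrite subrr ?mul0r ?mulr0 add0r.
  apply/negP; rewrite mulf_eq0 !subr_eq0 => /orP[/eqP h|/eqP h].
    by apply: pu; apply: vert; auto.
  by apply: pv; apply: vert; auto.
Qed.

(** * From drawings to one-page embeddings *)

(* [par] orients the tree towards the root [r]; [dep] is any measure that
   decreases along [par]. *)
Definition rooted_by n (T : edges n) (r : 'I_n) (par : 'I_n -> 'I_n)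
    (dep : 'I_n -> nat) :=
  par r = r /\
  forall v, v != r -> adj T (par v) v /\ (dep (par v) < dep v)%N.

(** [dep] is the distance to [r], and [par] picks the last vertex before the end of a shortest walk
    from [r]. *)
Lemma connected_rooted n (T : edges n) r :
  (forall u v, connect (adj T) u v) -> exists par dep, rooted_by T r par dep.
Proof.
move=> conT.
have walk v : exists m, [exists t : m.-tuple 'I_n,
    path (adj T) r t && (last r t == v)].
  have /connectP[t rt ->] := conT r v.
  by exists (size t); apply/existsP; exists (in_tuple t); rewrite rt eqxx.
pose dep v := ex_minn (walk v).
have pred v : exists w, v != r -> adj T w v /\ (dep w < dep v)%N.
  have [->|vr] := eqVneq v r; first by exists r.
  rewrite /dep; case: (ex_minnP (walk v)) => m /existsP[t /andP[rt /eqP tv]] _.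
  case/lastP E : (tval t) => [|t' w].
    by rewrite E /= in tv; rewrite tv eqxx in vr.
  rewrite E last_rcons in tv; rewrite E rcons_path tv in rt.
  case/andP: rt => rt t'v; exists (last r t') => _; split=> //.
  have -> : m = (size t').+1 by rewrite -(size_tuple t) E size_rcons.
  case: ex_minnP => k _ k_min; rewrite ltnS; apply: k_min.
  by apply/existsP; exists (in_tuple t'); rewrite rt eqxx.
have [par parP] := choice pred.
exists (fun v => if v == r then r else par v), dep; split; first by rewrite eqxx.
by move=> v vr; rewrite (negbTE vr); exact: parP.
Qed.

(** The reflexive ancestor relation, with the ancestor as first argument. *)
Definition anc n (par : 'I_n -> 'I_n) (u v : 'I_n) := fconnect par v u.

Lemma anc_refl n (par : 'I_n -> 'I_n) v : anc par v v.
Proof. exact: connect0. Qed.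

Lemma anc_trans n (par : 'I_n -> 'I_n) v u w :
  anc par u v -> anc par v w -> anc par u w.
Proof. by move=> uv vw; exact: connect_trans vw uv. Qed.

Lemma anc_par n (par : 'I_n -> 'I_n) v : anc par (par v) v.
Proof. exact: fconnect1. Qed.

Lemma anc_parent n (par : 'I_n -> 'I_n) u v :
  anc par u v -> u != v -> anc par u (par v).
Proof.
move=> /iter_findex <-; case: findex => [|k] /=; first by rewrite eqxx.
by move=> _; rewrite -iterS iterSr; exact: fconnect_iter.
Qed.

Lemma anc_comparable n (par : 'I_n -> 'I_n) u v w :
  anc par u w -> anc par v w -> anc par u v \/ anc par v u.
Proof.
move=> /iter_findex; move: (findex _ _ _) => i <-.
move=> /iter_findex; move: (findex _ _ _) => j <-.
have [/subnK <-|/ltnW/subnK <-] := leqP i j; [right|left];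
  by rewrite iterD; exact: fconnect_iter.
Qed.

Lemma anc_dep n (T : edges n) r par dep u v :
  rooted_by T r par dep -> anc par u v -> u != v -> (dep u < dep v)%N.
Proof.
move=> [parr parP] /iter_findex <-; elim: findex => [|k IHk]; first by rewrite eqxx.
move=> neq /=; have [E|kr] := eqVneq (iter k par v) r.
  by move: neq IHk => /=; rewrite E parr => neq; apply.
have [_ dk] := parP _ kr; have [Ek|nk] := eqVneq (iter k par v) v.
  by rewrite -{2}Ek.
by apply: ltn_trans dk (IHk nk).
Qed.

Lemma anc_root n (T : edges n) r par dep v :
  rooted_by T r par dep -> anc par r v.
Proof.
move=> [parr parP]; have [k] := ubnP (dep v); elim: k v => // k IHk v vk.
have [->|vr] := eqVneq v r; first exact: anc_refl.
have [_ dv] := parP _ vr; apply: anc_trans (anc_par _ _).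
by apply: IHk; apply: leq_trans dv _.
Qed.

(* An edge joining two vertices neither of which is the parent of the other
   would close a cycle with the parent edges. *)
Lemma tree_edge_parent n (T : edges n) r par dep u v :
  is_tree T -> rooted_by T r par dep -> adj T u v -> u = par v \/ v = par u.
Proof.
move=> [_ symT irrT _ acyc] rooted uv; have [parr parP] := rooted.
apply: contrapT => nopar.
(* The tree without the edge [(u, v)]. By assumption no parent edge is removed, so [u] and [v] stay
   connected through the root. *)
pose e := [rel x y | adj T x y && ((x, y) \notin [:: (u, v); (v, u)])].
have e_sym : symmetric e.
  move=> x y /=; rewrite symT; congr (_ && _); rewrite !inE !xpair_eqE.
  by rewrite orbC ![(y == _) && _]andbC.
have e_par x : connect e x (par x).
  have [->|xr] := eqVneq x r; first by rewrite parr.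
  apply: connect1; rewrite /= symT; have [-> _] := parP _ xr.
  rewrite !inE !xpair_eqE negb_or !negb_and /=.
  apply/andP; split; apply/orP.
    by have [->|] := eqVneq x u; [right; apply/eqP => ?; apply: nopar; right|left].
  by have [->|] := eqVneq x v; [right; apply/eqP => ?; apply: nopar; left|left].
have e_anc x y : anc par y x -> connect e x y.
  move=> /iter_findex <-; elim: findex => [|k IHk] //=.
  exact: connect_trans IHk (e_par _).
have : connect e u v.
  apply: (@connect_trans _ _ r).
    by apply: e_anc; apply: anc_root rooted.
  rewrite (sym_connect_sym e_sym); apply: e_anc; exact: anc_root rooted.
move=> /connectP[t0 /shortenP[t et ut _] vt].
have Tt : path (adj T) u t by apply: sub_path et => x y /andP[].
have : ucycle (adj T) (u :: t).
  by apply/andP; split; rewrite // /cycle rcons_path Tt -vt symT.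
(* Only cycles of at most two vertices remain: with one vertex [(u, v)] would be a loop, and with
   two the path would use the removed edge. *)
move/acyc; case: t et ut vt {Tt} => [|x [|y t]] et ut vt //= _.
  by rewrite vt /= irrT in uv.
by move: vt et => /= <-; rewrite !inE eqxx andbF.
Qed.

Lemma childless_leaf n (T : edges n) r par dep x :
  is_tree T -> rooted_by T r par dep -> x != r ->
  (forall w, w != r -> par w != x) -> leaf T x.
Proof.
move=> treeT rooted xr nochild; have [_ symT irrT _ _] := treeT.
have [parr parP] := rooted; have [px _] := parP _ xr.
rewrite /leaf (@eq_card _ _ (pred1 (par x))) ?card1 // => w.
rewrite inE -[w \in adj T x]/(adj T x w); apply/idP/eqP => [xw|->]; last by rewrite symT.
have [xE|//] := tree_edge_parent treeT rooted xw.
have [wr|wr] := eqVneq w r; last by have := nochild w wr; rewrite -xE eqxx.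
by move: xr; rewrite xE wr parr eqxx.
Qed.

(** A parent and a child would be two neighbours, distinct because their depths differ. *)
Lemma leaf_childless n (T : edges n) r par dep v w :
  is_tree T -> rooted_by T r par dep -> leaf T v -> v != r -> w != r ->
  par w != v.
Proof.
move=> [_ symT _ _ _] [_ parP] lv vr wr; apply/eqP => wv.
have [pv dv] := parP _ vr; have [pw dw] := parP _ wr; rewrite wv in pw dw.
have /card_le1_eqP/(_ (par v) w) E : (#|adj T v| <= 1)%N by rewrite (eqP lv).
have {}E : par v = w by apply/esym/E; rewrite // /in_mem /= symT.
by move: dv; rewrite E ltnNge ltnW.
Qed.

(** The root may itself be a leaf although it has descendants, whence the first alternative. *)
Lemma leaf_anc n (T : edges n) r par dep v x :
  is_tree T -> rooted_by T r par dep -> leaf T v -> anc par v x ->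
  v = r \/ v = x.
Proof.
move=> treeT rooted lv vx; have [->|vr] := eqVneq v r; first by left.
right; move: vx => /iter_findex; case: findex => [//|k] /= E.
have [kr|kr] := eqVneq (iter k par x) r.
  by case: rooted => parr _; move: vr; rewrite -E kr parr eqxx.
by have := leaf_childless treeT rooted lv vr kr; rewrite E eqxx.
Qed.

(** A deepest descendant of [v] has no child, so it is a leaf or the root, which is assumed to be a
    leaf. *)
Lemma leaf_below n (T : edges n) r par dep v :
  is_tree T -> rooted_by T r par dep -> leaf T r ->
  exists2 x, leaf T x & anc par v x.
Proof.
move=> treeT rooted lr; case: (arg_maxnP dep (anc_refl par v)) => x vx xmax.
exists x => //; have [->//|xr] := eqVneq x r.
apply: (childless_leaf treeT rooted xr) => w wr; apply/eqP => wx.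
have [_ /(_ w wr)[_]] := rooted; rewrite wx ltnNge => /negP[]; apply: xmax.
by apply: anc_trans vx _; rewrite -wx; exact: anc_par.
Qed.

Lemma connect_anc n (T : edges n) r par dep (A : {set 'I_n}) u y :
  is_tree T -> rooted_by T r par dep -> anc par u y ->
  (forall w, anc par u w -> anc par w y -> w \in A) ->
  connect (adj_in T A) y u.
Proof.
move=> [_ symT _ _ _] [parr parP] /iter_findex.
move: (findex _ _ _) => k; elim: k y => [|k IHk] y; first by move=> /= ->.
rewrite iterSr => uE yA.
have uy : anc par u (par y) by rewrite -uE; exact: fconnect_iter.
have {}IHk : connect (adj_in T A) (par y) u.
  apply: IHk => // w uw wy; apply: yA => //.
  by apply: anc_trans wy _; exact: anc_par.
have [yr|yr] := eqVneq y r; first by move: IHk; rewrite yr parr.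
apply: connect_trans IHk; apply: connect1; apply/and3P; split.
- by rewrite symT; case: (parP _ yr).
- by apply: yA; [apply: anc_trans uy _; exact: anc_par|exact: anc_refl].
- by apply: yA => //; exact: anc_par.
Qed.

Lemma adj_in_sym n (T : edges n) (A : {set 'I_n}) :
  symmetric (adj T) -> symmetric (adj_in T A).
Proof. by move=> symT u v; rewrite /adj_in symT andbA andbAC -andbA. Qed.

(** Root the tree at [u]: a deepest vertex is childless, hence a leaf unless it is the root. This
    covers the one-vertex tree, whose only vertex has degree 0. *)
Lemma leafless_tree n (T : edges n) (u v : 'I_n) :
  is_tree T -> (forall w, ~~ leaf T w) -> u = v.
Proof.
move=> treeT noleaf; have [_ _ _ conT _] := treeT.
have [par [dep rooted]] := connected_rooted u conT.
case: (arg_maxnP dep (isT : predT u)) => x _ xmax.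
have [xu|xu] := eqVneq x u; last first.
  suff : leaf T x by rewrite (negbTE (noleaf x)).
  apply: (childless_leaf treeT rooted xu) => w wu; apply/eqP => wx.
  by case: rooted => _ /(_ w wu)[_]; rewrite wx ltnNge => /negP[]; exact: xmax.
apply/eqP; apply: contraT => uv.
have := anc_dep rooted (anc_root v rooted) uv.
by rewrite ltnNge -xu => /negP[]; exact: xmax.
Qed.

Lemma sort_key_index (T : finType) (key : T -> nat) u v :
  injective key ->
  let s := sort (fun x y => (key x <= key y)%N) (enum T) in
  (index u s < index v s)%N = (key u < key v)%N.
Proof.
move=> key_inj s.
have s_full x : x \in s by rewrite mem_sort mem_enum.
have s_sorted : sorted (fun x y => (key x <= key y)%N) s.
  by apply: sort_sorted => x y; exact: leq_total.
have key_trans : transitive (fun x y => (key x <= key y)%N).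
  by move=> y x z; exact: leq_trans.
have sub x y : (index x s < index y s)%N -> (key x < key y)%N.
  move=> xy; rewrite ltn_neqAle (sorted_ltn_index key_trans s_sorted) // andbT.
  by apply: contraTneq xy => /key_inj ->; rewrite ltnn.
apply/idP/idP => [/sub//|uv]; rewrite ltnNge leq_eqVlt negb_or.
apply/andP; split; last first.
  by apply: contraTN uv => /sub; rewrite -leqNgt => /ltnW.
apply: contraTneq uv => vu.
by rewrite -[v](nth_index v (s_full v)) vu nth_index // ltnn.
Qed.

(* The order is the preorder of [T] rooted at the first leaf of [s], children
   being visited in the order of their first leaves. *)
Lemma book_of_represented (R : realType) n (T : edges n) (s : seq 'I_n) :
  is_tree T -> linear_order (leaf T) s -> represented R T s ->
  exists s', [/\ uniq s', forall u, u \in s', no_alternation s' T &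
    forall u v, leaf T u -> leaf T v ->
      (index u s' < index v s')%N = (index u s < index v s)%N].
Proof.
move=> treeT [uniq_s memE] rep; have [_ symT irrT conT _] := treeT.
have mem_s w : (w \in s) = leaf T w by rewrite memE.
case: s uniq_s memE mem_s rep => [|r s0] uniq_s memE mem_s rep.
  have noleaf w : ~~ leaf T w by rewrite -mem_s.
  exists (enum 'I_n); split; rewrite ?enum_uniq //.
  - by move=> u; rewrite mem_enum.
  - by move=> [a b] e _ _; rewrite /alternate (leafless_tree a b treeT noleaf) /= !inE eqxx.
  - by move=> u v; rewrite (negbTE (noleaf u)).
set s := r :: s0 in uniq_s memE mem_s rep *.
have lr : leaf T r by rewrite -mem_s mem_head.
have [par [dep rooted]] := connected_rooted r conT.
(* The position in [s] of the first leaf below [v]; that leaf is [low v]. *)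
pose m v := find (anc par v) s.
have has_leaf v : has (anc par v) s.
  have [x lx vx] := leaf_below v treeT rooted lr.
  by apply/hasP; exists x; rewrite ?mem_s.
pose low v := nth r s (m v).
have m_lt v : (m v < size s)%N by rewrite -has_find.
have anc_low v : anc par v (low v) by apply: nth_find.
have leaf_low v : leaf T (low v) by rewrite -mem_s mem_nth.
have index_low v : index (low v) s = m v by rewrite index_uniq.
have anc_r v : anc par v r -> v = r.
  move=> vr; apply/eqP; apply: contraT => neq.
  have h1 := anc_dep rooted vr neq; have := anc_root v rooted => rv.
  by rewrite eq_sym in neq; have := anc_dep rooted rv neq; rewrite ltnNge ltnW.
have m_anc u v : anc par u v -> (m u <= m v)%N.
  by move=> uv; apply: sub_find => x vx; exact: anc_trans uv vx.
have m_eq u v : m u = m v -> anc par u v \/ anc par v u.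
  move=> muv; apply: (anc_comparable (anc_low u)).
  by rewrite /low muv; exact: anc_low.
have m_leaf v : leaf T v -> m v = index v s.
  move=> lv; rewrite /m /index; have [->|vr] := eqVneq v r.
    by rewrite /= eqxx anc_refl.
  apply: eq_in_find => x; rewrite mem_s => lx /=.
  apply/idP/eqP => [vx|->]; last exact: anc_refl.
  have [E|//] := leaf_anc treeT rooted lv vx.
  by rewrite E eqxx in vr.
(* [N] exceeds all depths, so [key] orders the pairs [(m v, dep v)] lexicographically. Vertices with
   equal [m] are comparable by [m_eq], and the depth puts the ancestor first. *)
pose N := (\max_v dep v).+1; have dep_lt v : (dep v < N)%N.
  by rewrite ltnS leq_bigmax.
pose key v := (m v * N + dep v)%N.
have key_m u v : (m u < m v)%N -> (key u < key v)%N.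
  by move=> muv; rewrite /key; have := dep_lt u; nia.
have m_key u v : (key u < key v)%N -> (m u <= m v)%N.
  by apply: contraTT; rewrite -ltnNge -leqNgt => /key_m/ltnW.
have key_anc u v : anc par u v -> (key u <= key v)%N.
  move=> uv; have [->//|neq] := eqVneq u v.
  by rewrite leq_add ?leq_mul ?m_anc // ltnW // (anc_dep rooted uv).
have key_inj : injective key.
  move=> u v E; apply/eqP; apply: contraT => neq.
  have muv : m u = m v.
    by case: (ltngtP (m u) (m v)) => // /key_m; rewrite E ltnn.
  move: E; rewrite /key muv => /addnI E.
  case: (m_eq _ _ muv) => [|] h; first by have := anc_dep rooted h neq; rewrite E ltnn.
  by rewrite eq_sym in neq; have := anc_dep rooted h neq; rewrite E ltnn.
exists (sort (fun x y => (key x <= key y)%N) (enum 'I_n)).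
have s'_full u : u \in sort (fun x y => (key x <= key y)%N) (enum 'I_n).
  by rewrite mem_sort mem_enum.
split; rewrite ?sort_uniq ?enum_uniq //; last first.
  move=> u v lu lv; rewrite sort_key_index //; rewrite -!m_leaf //.
  apply/idP/idP => [uv|]; last exact: key_m.
  rewrite ltn_neqAle m_key // andbT !m_leaf //; apply: contraTneq uv => uv.
  have -> : u = v by rewrite -[u](nth_index u (_ : u \in s)) ?uv ?nth_index ?mem_s.
  by rewrite ltnn.
apply/(no_alternationP symT s'_full) => a b c d ab cd; rewrite !sort_key_index //.
move=> ac cb bd.
have parent u v : adj T u v -> (key u < key v)%N -> u = par v.
  move=> uv lt_uv; have [//|E] := tree_edge_parent treeT rooted uv.
  by have := key_anc v u; rewrite {1}E anc_par leqNgt lt_uv => /(_ isT).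
have aE := parent _ _ ab (ltn_trans ac cb).
have cE := parent _ _ cd (ltn_trans cb bd).
have not_anc u v : (key u < key v)%N -> ~~ anc par v u.
  by move=> uv; apply: contraL uv => /key_anc; rewrite leqNgt.
have neq_key u v : (key u < key v)%N -> u != v.
  by move=> uv; apply: contraTneq uv => ->; rewrite ltnn.
have cr : c != r.
  by apply: contraTneq ac => ->; rewrite -leqNgt key_anc // (anc_root a rooted).
have nbc : ~~ anc par b c := not_anc _ _ cb.
have ncb : ~~ anc par c b.
  apply/negP => h; have := anc_parent h (neq_key _ _ cb).
  by rewrite -aE (negbTE (not_anc _ _ ac)).
have nbd : ~~ anc par b d.
  apply/negP => h; have := anc_parent h (neq_key _ _ bd).
  by rewrite -cE (negbTE nbc).
have ndb : ~~ anc par d b := not_anc _ _ bd.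
have m_cb : (m c < m b)%N.
  rewrite ltn_neqAle m_key // andbT; apply/eqP => /m_eq[].
    by rewrite (negbTE ncb).
  by rewrite (negbTE nbc).
have m_bd : (m b < m d)%N.
  rewrite ltn_neqAle m_key // andbT; apply/eqP => /m_eq[].
    by rewrite (negbTE nbd).
  by rewrite (negbTE ndb).
(* The first leaf below [c] is not [r], so the leaves [r], [low c], [low b], [low d] occur in this
   order in [s]. *)
have m_c : (0 < m c)%N.
  rewrite lt0n; apply: contra cr => /eqP mc0; apply/eqP/anc_r.
  by have := anc_low c; rewrite /low mc0.
(* [A1] is the path from the root to [low b], and [A2] joins [low c] to [low d] inside the subtree
   of [c]. A common vertex would make [b] and [c] comparable. *)
pose A1 := [set w | anc par w (low b)]%SET.
pose A2 := [set w | anc par c w && (anc par w (low c) || anc par w (low d))]%SET.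
have c_d : anc par c (low d) by apply: anc_trans (anc_low d); rewrite cE anc_par.
apply: (@represented_not_alternating R n T s A1 A2 r (low b) (low c) (low d)) => //.
- move=> u; rewrite !inE => ub; apply/negP => /andP[cu _].
  case: (anc_comparable (anc_trans cu ub) (anc_low b)).
    by rewrite (negbTE ncb).
  by rewrite (negbTE nbc).
- by move=> u; rewrite inE => ub lu; exact: leaf_anc treeT rooted lu ub.
- move=> u; rewrite inE => /andP[cu uE] lu.
  have ur : u <> r by move=> ur; case/eqP: cr; apply: anc_r; rewrite -ur.
  by case/orP: uE => /(leaf_anc treeT rooted lu)[]; auto.
- rewrite (sym_connect_sym (adj_in_sym _ symT)).
  apply: (connect_anc treeT rooted); first exact: anc_root rooted.
  by move=> w _; rewrite inE.
- apply: (@connect_trans _ _ c).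
    apply: (connect_anc treeT rooted) => // w cw wc.
    by rewrite inE cw wc.
  rewrite (sym_connect_sym (adj_in_sym _ symT)).
  by apply: (connect_anc treeT rooted) => // w cw wd; rewrite inE cw wd orbT.
- by rewrite index_low /= eqxx.
- by rewrite !index_low.
- by rewrite !index_low.
Qed.

(** * The reduction *)

(** Every state is final, so the machine halts after 0 steps with its input as output. *)
Lemma polytime_id : polytime id.
Proof.
exists (@TuringMachine unit void tt predT (fun q a => (q, a, Stay))), 0.
by move=> w; rewrite /outputs_within horner0; split.
Qed.

(** Used with [D] the leaves: the given pages see only the relative order of the leaves, not the
    inner vertices placed between them. *)
Lemma no_alternation_congr n (E : edges n) (D : pred 'I_n) (s s' : seq 'I_n) :
  (forall e, e \in E -> D e.1 /\ D e.2) ->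
  (forall u v, D u -> D v ->
     (index u s < index v s)%N = (index u s' < index v s')%N) ->
  no_alternation s E -> no_alternation s' E.
Proof.
move=> ED ss' noalt e f eE fE; have [De1 De2] := ED e eE.
have [Df1 Df2] := ED f fE; have := noalt e f eE fE.
by rewrite /alternate /between !ss'.
Qed.

Theorem theorem3 (R : realType) (k : nat) (k_ge1 : (1 <= k)%N) :
  polytime_reducible (PTBE R k) (PBE k.+1).
Proof.
exists (fun x : ptbe_data k => PBEData [tuple of ptbe_tree x :: ptbe_pages x]), id.
split; [exact: polytime_id|by []|].
move=> [n T E] [/= treeT leafE]; split=> //; have [_ symT irrT _ _] := treeT.
split=> [[s [/= lin_s rep noalt]]|[s [[/= uniq_s s_full] noalt]]].
  have [s' [uniq_s' s'_full noaltT ss']] := book_of_represented treeT lin_s rep.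
  exists s'; split; first by split=> // u; rewrite s'_full.
  move=> i /=; have [j ->|->] := unliftP ord0 i; last by rewrite tnth0.
  rewrite tnthS; apply: no_alternation_congr (noalt j); first exact: leafE.
  by move=> u v lu lv; rewrite ss'.
have {}s_full u : u \in s by rewrite s_full.
exists [seq u <- s | leaf T u]; split.
- by split; [exact: filter_uniq|move=> u; rewrite mem_filter s_full andbT].
- by apply: represented_of_book => //; have := noalt ord0; rewrite tnth0.
- move=> i /=; have := noalt (lift ord0 i); rewrite tnthS.
  apply: no_alternation_congr; first exact: leafE.
  by move=> u v lu lv; rewrite ltn_index_filter.
Qed.
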